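(* Let $R$ be a commutative ring with identity (not necessarily finite) and let $k\in\mathbb{N}$. Then: (a) If $W_R(k)$ is connected with $\delta(W_R(k))<\infty$, then $g_R(k)$ exists and $g_R(k)=\delta(W_R(k))$. (b) If $G_R(k)$ is connected with $\delta(G_R(k))<\infty$, then $W_R(k)$ is also connected, $g_R(k)$ exists and $$g_R(k)=\delta(W_R(k))\le\delta(G_R(k)).$$
   Context: $R^*$ is the group of units of $R$ and $R^\times=R\smallsetminus\{0\}$. $G_R(k)=Cay(R,U_R(k))$ and $W_R(k)=Cay(R,S_R(k))$, where $U_R(k)=\{x^k:x\in R^*\}$, $S_R(k)=\{x^k:x\in R^\times\}$, and $Cay(R,S)$ is the directed graph with vertex set $R$ and an arc from $v$ to $w$ iff $w-v\in S$ (regarded as undirected if $S=-S$; $W_R(k)$ may have loops). The distance $d(u,v)$ is the length of a shortest directed walk from $u$ to $v$; the graph is connected if such a walk exists for all ordered pairs $u,v$, and the diameter $\delta$ is the greatest distance between vertices. The Waring number $g_R(k)$ is the minimum $s\in\mathbb{N}$, if it exists, such that $x_1^k+\cdots+x_s^k=r$ has a solution $(x_1,\dots,x_s)\in R^s$ for every $r\in R$. *)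

(* Defs.v *)
From HB Require Import structures.
From mathcomp Require Import all_boot all_order all_algebra.
From mathcomp Require Import classical_sets.

Set Implicit Arguments.
Unset Strict Implicit.
Unset Printing Implicit Defensive.

Import GRing.Theory.

Local Open Scope classical_set_scope.
Local Open Scope ring_scope.

(* A directed graph on V, loops allowed and V possibly infinite, is given by
   its arc relation. *)
Definition digraph (V : Type) := V -> V -> Prop.

Inductive walk (V : Type) (A : digraph V) : nat -> V -> V -> Prop :=
| walk_nil v : walk A 0 v v
| walk_cons n u v w : A u v -> walk A n v w -> walk A n.+1 u w.

Definition connected (V : Type) (A : digraph V) : Prop :=
  forall u v, exists n, walk A n u v.

Definition is_distance (V : Type) (A : digraph V) (u v : V) (n : nat) : Prop :=
  walk A n u v /\ forall m, walk A m u v -> (n <= m)%N.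

(* The distance is infinite when there is no walk, so a finite diameter
   requires every pair to be at a finite distance; "the diameter is finite" is
   [exists d, is_diameter A d]. *)
Definition is_diameter (V : Type) (A : digraph V) (d : nat) : Prop :=
  (forall u v, exists2 n, is_distance A u v n & (n <= d)%N) /\
  (exists u v, is_distance A u v d).

Definition Cay (V : zmodType) (S : set V) : digraph V := fun v w => S (w - v).

(* Units are spelled out, rather than taken from [unitRingType], so that R may
   be any commutative ring. *)
Definition units (R : comPzRingType) : set R := [set x | exists y, x * y = 1].
Arguments units R : clear implicits.

Definition unit_powers (R : comPzRingType) (k : nat) : set R :=
  [set x ^+ k | x in units R].
Arguments unit_powers R k : clear implicits.

Definition nonzero_powers (R : comPzRingType) (k : nat) : set R :=
  [set x ^+ k | x in [set x : R | x <> 0]].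
Arguments nonzero_powers R k : clear implicits.

Definition G_graph (R : comPzRingType) (k : nat) : digraph R :=
  Cay (unit_powers R k).
Arguments G_graph R k : clear implicits.

Definition W_graph (R : comPzRingType) (k : nat) : digraph R :=
  Cay (nonzero_powers R k).
Arguments W_graph R k : clear implicits.

Definition sums_of_powers (R : comPzRingType) (k s : nat) : Prop :=
  forall r : R, exists x : 'I_s -> R, \sum_(i < s) x i ^+ k = r.

(* The value s = 0 is only possible in the zero ring. *)
Definition is_waring_number (R : comPzRingType) (k s : nat) : Prop :=
  sums_of_powers R k s /\ forall t, sums_of_powers R k t -> (s <= t)%N.

(* Main.v *)
Require Import Defs.
From HB Require Import structures.
From mathcomp Require Import all_boot all_order all_algebra.
From mathcomp Require Import boolp classical_sets.

(** A walk of length n from u to v in a Cayley graph writes v - u as a sum of n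
    elements of the connection set.  For W_R(k) the summands are k-th powers of
    nonzero elements, whereas the Waring number also allows powers of 0.  Since
    0 ^ k = 0 for k > 0, zero summands only pad a sum, or can be deleted from it,
    so every element of R is a sum of exactly s k-th powers iff any two vertices
    of W_R(k) are joined by a walk of length at most s
    ([sums_of_powers_walks_within]).  The diameter of any graph with a vertex is
    the least s with the latter property ([is_diameter_least]); hence the Waring
    number and the diameter of W_R(k) are the same number, and one exists iff the
    other does ([waring_number_diameter]).

    A finite diameter e of G_R(k) writes every element of R as a sum of at most e
    k-th powers, because the connection set consists of k-th powers.  Padding
    again, every element is a sum of exactly e of them, which bounds the diameter
    of W_R(k) by e.  Going through sums, rather than comparing the graphs arc by
    arc, covers the zero ring, where 0 is a unit and the arcs of G_R(k) are not
    arcs of W_R(k). *)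

Set Implicit Arguments.
Unset Strict Implicit.
Unset Printing Implicit Defensive.

Import GRing.Theory.

Local Open Scope classical_set_scope.
Local Open Scope ring_scope.

Definition walks_within (V : Type) (A : digraph V) (s : nat) : Prop :=
  forall u v, exists2 n, walk A n u v & (n <= s)%N.

Lemma ex_least_nat (P : nat -> Prop) :
  (exists n, P n) -> exists2 n, P n & forall m, P m -> (n <= m)%N.
Proof.
move=> exP.
have exb : exists n, `[< P n >] by case: exP => n Pn; exists n; apply/asboolP.
case: (ex_minnP exb) => n /asboolP Pn min_n.
by exists n => // m Pm; apply/min_n/asboolP.
Qed.

(** The base point is essential: on an empty vertex set every bound holds, but
    no pair of vertices realises a diameter. *)
Lemma is_diameter_least (V : Type) (v0 : V) (A : digraph V) (d : nat) :
  is_diameter A d <->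
  walks_within A d /\ forall s, walks_within A s -> (d <= s)%N.
Proof.
split=> [[dist_le [u [v [_ min_d]]]] | [within_d min_d]].
  split=> [x y | s within_s].
    by have [n [walk_n _] le_nd] := dist_le x y; exists n.
  by have [n walk_n le_ns] := within_s u v; apply: leq_trans le_ns; apply: min_d.
have dist_le u v : exists2 n, is_distance A u v n & (n <= d)%N.
  have [m walk_m le_md] := within_d u v.
  have [n walk_n min_n] := ex_least_nat (ex_intro (walk A ^~ u ^~ v) m walk_m).
  by exists n => //; apply: leq_trans le_md; apply: min_n.
split=> //; case: d {within_d} min_d dist_le => [|d] min_d dist_le.
  by exists v0, v0; split=> //; apply: walk_nil.
(* If no pair were at distance d + 1, walks of length at most d would suffice. *)
apply: contrapT => no_pair.
suff /min_d : walks_within A d by rewrite ltnn.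
move=> u v; have [n dist_n le_nd] := dist_le u v.
exists n; first by case: dist_n.
rewrite -ltnS ltn_neqAle le_nd andbT; apply/eqP => eq_n.
by apply: no_pair; exists u, v; rewrite -eq_n.
Qed.

(** The unused positions of a sum of s powers are filled with 0 ^ k = 0. *)
Lemma Cay_walk_sum_powers (R : comPzRingType) (k : nat) (S : set R)
    (n s : nat) (u v : R) :
  (0 < k)%N -> S `<=` range (fun x : R => x ^+ k) ->
  walk (Cay S) n u v -> (n <= s)%N ->
  exists x : nat -> R, \sum_(i < s) x i ^+ k = v - u.
Proof.
move=> k_gt0 S_powers walk_n; elim: walk_n s => {n u v} [v | n u v w uv _ IHn] s.
  exists (fun=> 0); rewrite subrr big1 // => i _.
  by rewrite expr0n eqn0Ngt k_gt0.
case: s => // s /IHn[x sum_x].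
have [y _ y_uv] := S_powers _ uv.
exists (fun i => if i is j.+1 then x j else y).
by rewrite big_ord_recl /= sum_x y_uv addrC subrKA.
Qed.

(** Zero summands contribute no step, so the walk may be shorter than the sum. *)
Lemma W_walk_of_sum (R : comPzRingType) (k s : nat) (x : 'I_s -> R) (u : R) :
  (0 < k)%N ->
  exists2 n, walk (W_graph R k) n u (u + \sum_(i < s) x i ^+ k) & (n <= s)%N.
Proof.
move=> k_gt0; elim: s x u => [|s IHs] x u.
  by exists 0; rewrite // big_ord0 addr0; apply: walk_nil.
have [n walk_n le_ns] := IHs (x \o lift ord0) (u + x ord0 ^+ k).
rewrite big_ord_recl addrA.
have [x0 | x_neq0] := pselect (x ord0 = 0).
  exists n; last exact: leqW.
  by move: walk_n; rewrite x0 expr0n eqn0Ngt k_gt0 addr0.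
exists n.+1 => //; apply: walk_cons walk_n.
by exists (x ord0) => //; rewrite addrC addKr.
Qed.

Lemma Cay_walks_within_sums (R : comPzRingType) (k : nat) (S : set R) (s : nat) :
  (0 < k)%N -> S `<=` range (fun x : R => x ^+ k) ->
  walks_within (Cay S) s -> sums_of_powers R k s.
Proof.
move=> k_gt0 S_powers within_s r; have [n walk_n le_ns] := within_s 0 r.
have [x sum_x] := Cay_walk_sum_powers k_gt0 S_powers walk_n le_ns.
by exists x; rewrite sum_x subr0.
Qed.

Lemma sums_of_powers_walks_within (R : comPzRingType) (k s : nat) :
  (0 < k)%N -> sums_of_powers R k s <-> walks_within (W_graph R k) s.
Proof.
move=> k_gt0; split=> [sums u v | ].
  have [x sum_x] := sums (v - u).
  by have := W_walk_of_sum x u k_gt0; rewrite sum_x addrC subrK.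
by apply: Cay_walks_within_sums => // _ [x _ <-]; exists x.
Qed.

Lemma waring_number_diameter (R : comPzRingType) (k s : nat) :
  (0 < k)%N -> is_waring_number R k s <-> is_diameter (W_graph R k) s.
Proof.
move=> k_gt0; have sumsE t := sums_of_powers_walks_within R t k_gt0.
apply: iff_trans (iff_sym (is_diameter_least 0 _ _)).
by split=> -[/sumsE Ps min_s]; split=> // t /sumsE; apply: min_s.
Qed.

Theorem theorem3p1 (R : comPzRingType) (k : nat) (k_gt0 : (0 < k)%N) :
  (connected (W_graph R k) ->
   forall d : nat, is_diameter (W_graph R k) d ->
   exists2 g : nat, is_waring_number R k g & g = d)
  /\
  (connected (G_graph R k) ->
   forall e : nat, is_diameter (G_graph R k) e ->
   connected (W_graph R k) /\
   exists g d : nat, [/\ is_waring_number R k g,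
     is_diameter (W_graph R k) d, g = d & (d <= e)%N]).
Proof.
split=> [_ d diam_d | _ e /(is_diameter_least 0)[within_e _]].
  by exists d => //; apply/waring_number_diameter.
have sums_e : sums_of_powers R k e.
  by apply: Cay_walks_within_sums within_e => // _ [x _ <-]; exists x.
split=> [u v|].
  have [n walk_n _] := (sums_of_powers_walks_within R e k_gt0).1 sums_e u v.
  by exists n.
have [g sums_g min_g] := ex_least_nat (ex_intro _ e sums_e).
have waring_g : is_waring_number R k g by [].
exists g, g; split=> //; first exact/waring_number_diameter.
exact: min_g.
Qed.
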